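(* Let $a>0$, $\nu>0$, $\beta\ge 0$ be constants, and let $S^2(a^2)$ be the round sphere of radius $1/a$ with base point $O$ and normal polar coordinates $(r,\theta)$ about $O$. Let $\delta\in(0,\frac{\pi}{a})$ and $\tau\in(0,2\pi)$, let $K\subset S^2(a^2)$ be a compact set with $K\subset\{p\in S^2(a^2): d(p,O)\le\delta\}$ whose boundary contains the circular arc $C_{\delta,\tau}=\{p\in S^2(a^2): d(p,O)=\delta,\ 0<\theta(p)<\tau\}$, let $\epsilon_0>0$ be any positive number with $\delta+\epsilon_0<\frac{\pi}{a}$, and consider the simply-connected exterior region $$R_{\delta,\tau,\epsilon_0}=\{p\in S^2(a^2): \delta<d(p,O)<\delta+\epsilon_0,\ 0<\theta(p)<\tau\}.$$ Then for the quadratic profile (Poiseuille flow profile) $h(\lambda)=\alpha_1\lambda-\frac{\alpha_2}{2}\lambda^2$, with any $\alpha_1>0$ and $\alpha_2>0$, the parallel laminar flow $$u=-h(r-\delta)\,\frac{a}{\sin(ar)}\,\frac{\partial}{\partial\theta}$$ does not solve the stationary Navier-Stokes equation $$\nu\big((-\triangle)u^*-2\,\mathrm{Ric}(u^* )\big)+\beta\cos(ar)\,{*u^*}+[\overline{\nabla}_u u]^*+dP=0,\qquad d^*u^*=0$$ in $R_{\delta,\tau,\epsilon_0}$; that is, there is no smooth function $P$ on $R_{\delta,\tau,\epsilon_0}$ for which $(u,P)$ satisfies this system on $R_{\delta,\tau,\epsilon_0}$.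
   Context: $S^2(a^2)=\{(x_1,x_2,x_3)\in\mathbb{R}^3: x_1^2+x_2^2+x_3^2=\frac{1}{a^2}\}$ carries the Riemannian metric $g$ induced from $\mathbb{R}^3$ (constant sectional curvature $a^2$); $d(\cdot,\cdot)$ is its geodesic distance. The base point is the North Pole $O=(0,0,\frac1a)$. The exponential map $\exp_O:\{v\in T_OS^2(a^2):\|v\|<\frac{\pi}{a}\}\to S^2(a^2)\setminus\{-O\}$ is a diffeomorphism; identifying $T_OS^2(a^2)$ with $\mathbb{R}^2$ by a positively oriented orthonormal basis, the normal polar coordinate system is $(r,\theta)=(\overline r,\overline\theta)\circ\exp_O^{-1}$, where $(\overline r,\overline\theta)$ are the standard polar coordinates on $\mathbb{R}^2\setminus\{(x_1,0):x_1\ge0\}$ with values in $(0,\infty)\times(0,2\pi)$. So $r(p)=d(p,O)\in(0,\frac{\pi}{a})$, $\theta\in(0,2\pi)$, and $\frac{\partial}{\partial r},\frac{\partial}{\partial\theta}$ are the induced coordinate vector fields; the metric is $g=dr^2+\frac{\sin^2(ar)}{a^2}d\theta^2$, and $(dr,d\theta)$ is positively oriented. For a smooth vector field $X$, $X^*=g(X,\cdot)$ is the associated $1$-form. $\overline\nabla$ is the Levi-Civita connection. $*$ is the Hodge star, with $*dr=\frac{\sin(ar)}{a}d\theta$, $*d\theta=-\frac{a}{\sin(ar)}dr$, and $*\mathrm{Vol}=1$ where $\mathrm{Vol}=\frac{\sin(ar)}{a}dr\wedge d\theta$. $d^*=-*d*$ is the formal adjoint of the exterior derivative $d$ (on $1$-forms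 $d^*u^*=-\mathrm{div}\,u$), and $(-\triangle)=dd^*+d^*d$ is the Hodge Laplacian on $1$-forms. $\mathrm{Ric}$ is the Ricci tensor acting on $1$-forms; on $S^2(a^2)$, $\mathrm{Ric}(u^* )=a^2u^*$. The constant $\nu>0$ is the viscosity, $\beta\ge0$ is the constant rotation speed of the sphere. A vector field $u$ ''solves'' the equation in a region if there is a smooth pressure function $P$ on that region such that the system holds there. *)

(* Defs.v *)
From Stdlib Require Import Reals Lra List FunctionalExtensionality.
From Coquelicot Require Import Coquelicot.
Open Scope R_scope.

(** * Euclidean three-space *)

Definition vec3 : Type := (R * R * R)%type.

Definition x1 (p : vec3) : R := fst (fst p).
Definition x2 (p : vec3) : R := snd (fst p).
Definition x3 (p : vec3) : R := snd p.

Definition vadd (p q : vec3) : vec3 := (x1 p + x1 q, x2 p + x2 q, x3 p + x3 q).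
Definition vscal (c : R) (p : vec3) : vec3 := (c * x1 p, c * x2 p, c * x3 p).
Definition dot (p q : vec3) : R := x1 p * x1 q + x2 p * x2 q + x3 p * x3 q.
Definition vnorm (p : vec3) : R := sqrt (dot p p).

Definition vderiv (c : R -> vec3) (t : R) : vec3 :=
  (Derive (fun s => x1 (c s)) t,
   Derive (fun s => x2 (c s)) t,
   Derive (fun s => x3 (c s)) t).

Definition compact_set (K : vec3 -> Prop) : Prop :=
  forall (I : Type) (U : I -> vec3 -> Prop),
    (forall i, open (U i)) ->
    (forall p, K p -> exists i, U i p) ->
    exists l : list I, forall p, K p -> exists i, In i l /\ U i p.

(** Topological boundary of [K] relative to the ambient space [S]. *)
Definition boundary_in (S K : vec3 -> Prop) (p : vec3) : Prop :=
  S p /\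
  forall V : vec3 -> Prop, open V -> V p ->
    (exists q, V q /\ S q /\ K q) /\ (exists q, V q /\ S q /\ ~ K q).

(** * The sphere of radius [1/a] *)

Definition sphere (a : R) (p : vec3) : Prop :=
  x1 p ^ 2 + x2 p ^ 2 + x3 p ^ 2 = 1 / a ^ 2.

Definition north (a : R) : vec3 := (0, 0, 1 / a).

Definition C1_real (f : R -> R) : Prop :=
  forall t, ex_derive f t /\ continuous (Derive f) t.

(** The curve is parametrized by [0,1]; it is [C1] on the whole line only to
    avoid one-sided derivatives at the end points. *)
Definition sphere_curve (a : R) (p q : vec3) (c : R -> vec3) : Prop :=
  C1_real (fun t => x1 (c t)) /\
  C1_real (fun t => x2 (c t)) /\
  C1_real (fun t => x3 (c t)) /\
  (forall t, 0 <= t <= 1 -> sphere a (c t)) /\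
  c 0 = p /\ c 1 = q.

Definition curve_length (c : R -> vec3) : R :=
  RInt (fun t => vnorm (vderiv c t)) 0 1.

Definition geodesic_dist (a : R) (p q : vec3) : R :=
  real (Glb_Rbar (fun L => exists c, sphere_curve a p q c /\ L = curve_length c)).

Definition tangent_north (a : R) (v : vec3) : Prop := dot v (north a) = 0.

(** The geodesic issued from the North Pole with initial velocity [v], i.e. a
    great circle (see [great_circle_geodesic]).  For [v = 0] the quotient is
    harmless, since it multiplies [v]. *)
Definition great_circle (a : R) (v : vec3) (t : R) : vec3 :=
  vadd (vscal (cos (a * vnorm v * t)) (north a))
       (vscal (sin (a * vnorm v * t) / (a * vnorm v)) v).

Definition exp_north (a : R) (v : vec3) : vec3 := great_circle a v 1.

Lemma vnorm_sq (v : vec3) : vnorm v * vnorm v = dot v v.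
Proof. unfold vnorm. apply sqrt_sqrt. unfold dot. nra. Qed.

Lemma great_circle_geodesic (a : R) (v : vec3) :
  0 < a -> tangent_north a v ->
  great_circle a v 0 = north a /\
  vderiv (great_circle a v) 0 = v /\
  (forall t, sphere a (great_circle a v t)) /\
  (forall t, vderiv (vderiv (great_circle a v)) t
             = vscal (- (a * vnorm v) ^ 2) (great_circle a v t)).
Proof.
intros ha hv.
assert (hn := vnorm_sq v).
destruct v as [[b c] e].
assert (he : e = 0).
{ unfold tangent_north, dot, north, x1, x2, x3 in hv; simpl in hv.
  assert (0 < 1 / a) by (apply Rdiv_lt_0_compat; lra). nra. }
subst e.
set (n := vnorm (b, c, 0)) in *.
assert (hn0 : 0 <= n) by apply sqrt_pos.
assert (hd : dot (b, c, 0) (b, c, 0) = b * b + c * c)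
  by (unfold dot, x1, x2, x3; simpl; ring).
rewrite hd in hn; clear hd.
assert (hbc : n = 0 -> b = 0 /\ c = 0) by (intros h; rewrite h in hn; split; nra).
assert (hg : great_circle a (b, c, 0) = fun t =>
  (sin (a * n * t) / (a * n) * b, sin (a * n * t) / (a * n) * c, cos (a * n * t) / a)).
{ apply functional_extensionality; intros t.
  unfold great_circle, vadd, vscal, north, x1, x2, x3; simpl. fold n.
  apply f_equal2; [apply f_equal2|]; [ring|ring|unfold Rdiv; ring]. }
rewrite hg.
assert (hD : forall t, vderiv (fun t => (sin (a * n * t) / (a * n) * b,
   sin (a * n * t) / (a * n) * c, cos (a * n * t) / a)) t =
   (cos (a * n * t) * b, cos (a * n * t) * c, - n * sin (a * n * t))).
{ intros t. unfold vderiv, x1, x2, x3; simpl.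
  destruct (Req_dec n 0) as [h0|h0].
  - destruct (hbc h0) as [-> ->]. rewrite h0.
    apply f_equal2; [apply f_equal2|]; apply is_derive_unique; auto_derive; auto; try ring; field; lra.
  - apply f_equal2; [apply f_equal2|]; apply is_derive_unique; auto_derive; auto; field; repeat split; auto; lra. }
assert (hs : forall x, sin x * sin x + cos x * cos x = 1)
  by (intros x; generalize (sin2_cos2 x); unfold Rsqr; auto).
split; [|split; [|split]].
- simpl. unfold north. rewrite !Rmult_0_r, sin_0, cos_0.
  apply f_equal2; [apply f_equal2|]; unfold Rdiv; ring.
- rewrite hD, !Rmult_0_r, sin_0, cos_0. apply f_equal2; [apply f_equal2|]; ring.
- intros t. unfold sphere, x1, x2, x3; simpl.
  assert (h := hs (a * n * t)).
  destruct (Req_dec n 0) as [h0|h0].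
  + destruct (hbc h0) as [-> ->]. rewrite h0, !Rmult_0_r, !Rmult_0_l, cos_0. field; lra.
  + assert (hq : (sin (a * n * t) * sin (a * n * t)) * (b * b + c * c)
       = (1 - cos (a * n * t) * cos (a * n * t)) * (n * n)) by (rewrite hn, <- h; ring).
    transitivity ((sin (a * n * t) * sin (a * n * t)) * (b * b + c * c) / (a * a * (n * n))
       + cos (a * n * t) * cos (a * n * t) / (a * a)); [field; lra|].
    rewrite hq. field; lra.
- intros t.
  transitivity (vderiv (fun t => (cos (a * n * t) * b, cos (a * n * t) * c,
     - n * sin (a * n * t))) t).
  { f_equal. apply functional_extensionality. exact hD. }
  unfold vderiv, vscal, x1, x2, x3; simpl.
  destruct (Req_dec n 0) as [h0|h0].
  + destruct (hbc h0) as [-> ->]. rewrite h0.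
    apply f_equal2; [apply f_equal2|]; apply is_derive_unique; auto_derive; auto; try ring; field; repeat split; auto; lra.
  + apply f_equal2; [apply f_equal2|]; apply is_derive_unique; auto_derive; auto; try ring; field; repeat split; auto; lra.
Qed.

(** An orthonormal basis of the tangent plane at the North Pole.  The sphere
    carries the orientation for which this basis is positive. *)
Definition orthonormal_at_north (a : R) (e1 e2 : vec3) : Prop :=
  tangent_north a e1 /\ tangent_north a e2 /\
  dot e1 e1 = 1 /\ dot e2 e2 = 1 /\ dot e1 e2 = 0.

Definition polar_chart (a : R) (e1 e2 : vec3) (r th : R) : vec3 :=
  exp_north a (vadd (vscal (r * cos th) e1) (vscal (r * sin th) e2)).

Definition polar_coords (a : R) (e1 e2 : vec3) (p : vec3) (r th : R) : Prop :=
  0 < r < PI / a /\ 0 < th < 2 * PI /\ p = polar_chart a e1 e2 r th.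

(** [p] has a polar angle, and this angle lies in [(0,tau)]. *)
Definition angle_below (a : R) (e1 e2 : vec3) (tau : R) (p : vec3) : Prop :=
  exists r th, polar_coords a e1 e2 p r th /\ 0 < th < tau.

Definition arc (a : R) (e1 e2 : vec3) (delta tau : R) (p : vec3) : Prop :=
  sphere a p /\ geodesic_dist a p (north a) = delta /\ angle_below a e1 e2 tau p.

Definition exterior_region (a : R) (e1 e2 : vec3) (delta tau eps0 : R)
    (p : vec3) : Prop :=
  sphere a p /\
  delta < geodesic_dist a p (north a) < delta + eps0 /\
  angle_below a e1 e2 tau p.

(** * Riemannian calculus in an oriented two-dimensional chart

    Scalar functions, and components of tensor fields, are functions of the two
    coordinates; a 2-form is given by its coefficient on [dr /\ dtheta]. *)

Inductive coord : Set := Rad | Ang.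

Definition field : Type := R -> R -> R.
Definition vfield : Type := coord -> field.
Definition form1 : Type := coord -> field.
Definition metric : Type := coord -> coord -> field.

Definition sumc (f : coord -> R) : R := f Rad + f Ang.

Definition pd (i : coord) (f : field) : field :=
  match i with
  | Rad => fun r th => Derive (fun s => f s th) r
  | Ang => fun r th => Derive (fun s => f r s) th
  end.

Definition ex_pd (i : coord) (f : field) (r th : R) : Prop :=
  match i with
  | Rad => ex_derive (fun s => f s th) r
  | Ang => ex_derive (fun s => f r s) th
  end.

(** [k] times continuous differentiability on an open set [D]. *)
Fixpoint Ck_on (k : nat) (D : R -> R -> Prop) (f : field) : Prop :=
  (forall r th, D r th -> continuous (fun z : R * R => f (fst z) (snd z)) (r, th)) /\
  match k with
  | O => True
  | S k' => forall i, (forall r th, D r th -> ex_pd i f r th) /\ Ck_on k' D (pd i f)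
  end.

Definition smooth_on (D : R -> R -> Prop) (f : field) : Prop :=
  forall k, Ck_on k D f.

Definition gdet (G : metric) : field := fun r th =>
  G Rad Rad r th * G Ang Ang r th - G Rad Ang r th * G Ang Rad r th.

Definition ginv (G : metric) (i j : coord) : field := fun r th =>
  match i, j with
  | Rad, Rad => G Ang Ang r th / gdet G r th
  | Ang, Ang => G Rad Rad r th / gdet G r th
  | Rad, Ang => - G Rad Ang r th / gdet G r th
  | Ang, Rad => - G Ang Rad r th / gdet G r th
  end.

Definition flat (G : metric) (X : vfield) : form1 := fun i r th =>
  sumc (fun j => G i j r th * X j r th).

Definition sharp (G : metric) (w : form1) : vfield := fun i r th =>
  sumc (fun j => ginv G i j r th * w j r th).

(** [christoffel G k i j] is Gamma^k_{ij}. *)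
Definition christoffel (G : metric) (k i j : coord) : field := fun r th =>
  / 2 * sumc (fun l => ginv G k l r th *
    (pd i (G j l) r th + pd j (G i l) r th - pd l (G i j) r th)).

(** Levi-Civita covariant derivative of [Y] along [X]. *)
Definition nabla (G : metric) (X Y : vfield) : vfield := fun k r th =>
  sumc (fun i => X i r th *
    (pd i (Y k) r th + sumc (fun j => christoffel G k i j r th * Y j r th))).

(** [riemann G l k i j] is the [l]-component of R(d_i, d_j) d_k, where
    R(X,Y) = [nabla_X, nabla_Y] - nabla_[X,Y]. *)
Definition riemann (G : metric) (l k i j : coord) : field := fun r th =>
  pd i (christoffel G l j k) r th - pd j (christoffel G l i k) r th
  + sumc (fun m => christoffel G l i m r th * christoffel G m j k r th
                   - christoffel G l j m r th * christoffel G m i k r th).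

Definition ricci (G : metric) (j k : coord) : field := fun r th =>
  sumc (fun i => riemann G i k i j r th).

Definition ricci1 (G : metric) (w : form1) : form1 := fun j r th =>
  sumc (fun k => ricci G j k r th * sharp G w k r th).

Definition vol (G : metric) : field := fun r th => sqrt (gdet G r th).

Definition ext_d0 (f : field) : form1 := fun i => pd i f.
Definition ext_d1 (w : form1) : field := fun r th =>
  pd Rad (w Ang) r th - pd Ang (w Rad) r th.

(** Hodge star on 1-forms, contraction of the volume form with [sharp G w];
    [star0] and [star2] act on functions and on 2-forms. *)
Definition star1 (G : metric) (w : form1) : form1 := fun i r th =>
  match i with
  | Rad => - vol G r th * sharp G w Ang r th
  | Ang => vol G r th * sharp G w Rad r th
  end.
Definition star0 (G : metric) (f : field) : field := fun r th =>
  vol G r th * f r th.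
Definition star2 (G : metric) (f : field) : field := fun r th =>
  f r th / vol G r th.

Definition codiff1 (G : metric) (w : form1) : field := fun r th =>
  - star2 G (ext_d1 (star1 G w)) r th.
Definition codiff2 (G : metric) (f : field) : form1 := fun i r th =>
  - star1 G (ext_d0 (star2 G f)) i r th.

Definition hodge_laplacian (G : metric) (w : form1) : form1 := fun i r th =>
  ext_d0 (codiff1 G w) i r th + codiff2 G (ext_d1 w) i r th.

(** * The rotating sphere in polar coordinates *)

Definition chart_frame (a : R) (e1 e2 : vec3) (i : coord) (r th : R) : vec3 :=
  match i with
  | Rad => vderiv (fun s => polar_chart a e1 e2 s th) r
  | Ang => vderiv (fun s => polar_chart a e1 e2 r s) th
  end.

(** The metric induced from three-space. *)
Definition sphere_metric (a : R) (e1 e2 : vec3) : metric := fun i j r th =>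
  dot (chart_frame a e1 e2 i r th) (chart_frame a e1 e2 j r th).

Definition chart_domain (a : R) (e1 e2 : vec3) (D : vec3 -> Prop) (r th : R) : Prop :=
  0 < r < PI / a /\ 0 < th < 2 * PI /\ D (polar_chart a e1 e2 r th).

(** [u] (given by its components on d/dr, d/dtheta) and [P] satisfy the
    stationary Navier-Stokes system with viscosity [nu] and rotation speed
    [beta] on [D], a set contained in the range of the polar chart. *)
Definition navier_stokes_on (a nu beta : R) (e1 e2 : vec3) (D : vec3 -> Prop)
    (u : vfield) (P : vec3 -> R) : Prop :=
  let G := sphere_metric a e1 e2 in
  let w := flat G u in
  let p := fun r th => P (polar_chart a e1 e2 r th) in
  smooth_on (chart_domain a e1 e2 D) p /\
  forall r th, chart_domain a e1 e2 D r th ->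
    (forall i : coord,
       nu * (hodge_laplacian G w i r th - 2 * ricci1 G w i r th)
       + beta * cos (a * r) * star1 G w i r th
       + flat G (nabla G u u) i r th
       + ext_d0 p i r th = 0) /\
    codiff1 G w r th = 0.

Definition solves_navier_stokes (a nu beta : R) (e1 e2 : vec3) (D : vec3 -> Prop)
    (u : vfield) : Prop :=
  exists P : vec3 -> R, navier_stokes_on a nu beta e1 e2 D u P.

Definition poiseuille (alpha1 alpha2 lambda : R) : R :=
  alpha1 * lambda - alpha2 / 2 * lambda ^ 2.

Definition laminar_flow (a delta : R) (h : R -> R) : vfield := fun i r _ =>
  match i with
  | Rad => 0
  | Ang => - h (r - delta) * (a / sin (a * r))
  end.

(* Main.v *)
Require Import Defs.
From Stdlib Require Import Reals Lra FunctionalExtensionality.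
From Coquelicot Require Import Coquelicot.
Open Scope R_scope.

(** In polar coordinates the metric is [dr^2 + (sin (a r) / a)^2 dtheta^2] and the flow
    depends on [r] only, so the system prescribes both partial derivatives of the pressure
    as functions of [r] alone.  Integrating the [theta]-derivative over a [theta]-interval
    and then differentiating in [r] shows that the [theta]-derivative of the pressure is
    constant.  For the quadratic profile [h] this constant is, up to the factor [-nu],
    [h'' S + h' C + h (2 a^2 S - 1/S)] with [S = sin (a r) / a] and [C = cos (a r)]; its
    constancy leads to a linear relation between [sin (a r)] and [cos (a r)] with polynomial
    coefficients, which together with its derivative forces a nonzero quartic polynomial to
    vanish on an interval.

    The region is described by the geodesic distance, which equals [r] because
    [acos (k a x3)], for every [k] in [(0,1)], changes along a curve by at most [a] times the
    length of the curve. *)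

(** * The polar chart and the metric it induces *)

Lemma sin_sq_cos_sq (x : R) : sin x * sin x + cos x * cos x = 1.
Proof. generalize (sin2_cos2 x); unfold Rsqr; auto. Qed.

Lemma tangent_north_x3 (a : R) (v : vec3) : 0 < a -> tangent_north a v -> x3 v = 0.
Proof.
intros ha hv; unfold tangent_north, dot, north, x1, x2, x3 in *; simpl in *.
assert (0 < 1 / a) by (apply Rdiv_lt_0_compat; lra); nra.
Qed.

(* Valid for every real [r]: both [sin (a * |r|) / (a * |r|) * r] and
   [sin (a * r) / a] are odd in [r], and at [r = 0] both sides vanish. *)
Lemma polar_chartE (a : R) (e1 e2 : vec3) : 0 < a -> orthonormal_at_north a e1 e2 ->
  polar_chart a e1 e2 = fun r th =>
    (sin (a * r) / a * (cos th * x1 e1 + sin th * x1 e2),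
     sin (a * r) / a * (cos th * x2 e1 + sin th * x2 e2),
     cos (a * r) / a).
Proof.
intros ha (t1 & t2 & n1 & n2 & n12).
apply tangent_north_x3 in t1; auto; apply tangent_north_x3 in t2; auto.
apply functional_extensionality; intros r; apply functional_extensionality; intros th.
unfold polar_chart, exp_north, great_circle.
set (v := vadd (vscal (r * cos th) e1) _).
assert (hv : vnorm v = Rabs r).
{ unfold vnorm; replace (dot v v) with (Rsqr r); [apply sqrt_Rsqr_abs|].
  assert (hs := sin_sq_cos_sq th).
  transitivity (r * r * ((cos th * cos th) * dot e1 e1
     + (sin th * sin th) * dot e2 e2 + 2 * (sin th * cos th) * dot e1 e2)).
  - rewrite n1, n2, n12; unfold Rsqr; nra.
  - unfold v, vadd, vscal, dot, x1, x2, x3; simpl; ring. }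
rewrite hv.
assert (hc : cos (a * Rabs r * 1) = cos (a * r)).
{ rewrite Rmult_1_r; unfold Rabs; destruct (Rcase_abs r); auto.
  rewrite <- (cos_neg (a * r)); f_equal; ring. }
assert (hs : sin (a * Rabs r * 1) / (a * Rabs r) * r = sin (a * r) / a).
{ destruct (Req_dec r 0) as [->|hr].
  - rewrite !Rmult_0_r, sin_0; unfold Rdiv; ring.
  - unfold Rabs; destruct (Rcase_abs r).
    + replace (a * - r * 1) with (- (a * r)) by ring.
      rewrite sin_neg; field; lra.
    + replace (a * r * 1) with (a * r) by ring; field; lra. }
rewrite hc; unfold v, vadd, vscal, north.
unfold x3 in t1, t2.
unfold x1, x2, x3; simpl; rewrite t1, t2.
apply f_equal2; [apply f_equal2|]; rewrite <- ?hs; unfold Rdiv; ring.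
Qed.

Lemma polar_chart_sphere (a : R) (e1 e2 : vec3) (r th : R) :
  0 < a -> orthonormal_at_north a e1 e2 -> sphere a (polar_chart a e1 e2 r th).
Proof.
intros ha he; rewrite polar_chartE by auto.
destruct he as (t1 & t2 & n1 & n2 & n12).
apply tangent_north_x3 in t1; auto; apply tangent_north_x3 in t2; auto.
unfold dot in *; rewrite t1, t2 in *; unfold sphere, x1, x2, x3 in *; simpl in *.
assert (h := sin_sq_cos_sq th); assert (h' := sin_sq_cos_sq (a * r)).
set (b1 := fst (fst e1)) in *; set (c1 := snd (fst e1)) in *.
set (b2 := fst (fst e2)) in *; set (c2 := snd (fst e2)) in *.
(* The sum is grouped into the inner products of [e1] and [e2]; each [0 * 0] stands for a product of
   third coordinates, so that the orthonormality equations rewrite literally. *)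
transitivity ((sin (a * r) * sin (a * r) * (cos th * cos th * (b1 * b1 + c1 * c1 + 0 * 0)
  + sin th * sin th * (b2 * b2 + c2 * c2 + 0 * 0) + 2 * sin th * cos th * (b1 * b2 + c1 * c2 + 0 * 0))
  + cos (a * r) * cos (a * r)) / a ^ 2).
- field; lra.
- rewrite n1, n2, n12; replace (_ + cos (a * r) * cos (a * r)) with 1; [field; lra|nra].
Qed.

Definition round_metric (a : R) : metric := fun i j r _ =>
  match i, j with
  | Rad, Rad => 1
  | Ang, Ang => (sin (a * r) / a) ^ 2
  | _, _ => 0
  end.

Lemma chart_frameE (a : R) (e1 e2 : vec3) (i : coord) (r th : R) :
  0 < a -> orthonormal_at_north a e1 e2 ->
  chart_frame a e1 e2 i r th =
  match i with
  | Rad => (cos (a * r) * (cos th * x1 e1 + sin th * x1 e2),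
            cos (a * r) * (cos th * x2 e1 + sin th * x2 e2), - sin (a * r))
  | Ang => (sin (a * r) / a * (cos th * x1 e2 - sin th * x1 e1),
            sin (a * r) / a * (cos th * x2 e2 - sin th * x2 e1), 0)
  end.
Proof.
intros ha he; unfold chart_frame; rewrite polar_chartE by auto.
destruct i; unfold vderiv; apply f_equal2; try apply f_equal2;
  apply is_derive_unique; unfold x1, x2, x3; simpl; auto_derive; auto; field; lra.
Qed.

(** Orthonormality makes [e1] and [e2] disappear, so that the tensor calculus below works with
    functions of [r] alone. *)
Lemma sphere_metricE (a : R) (e1 e2 : vec3) : 0 < a -> orthonormal_at_north a e1 e2 ->
  sphere_metric a e1 e2 = round_metric a.
Proof.
intros ha he.
apply functional_extensionality; intros i; apply functional_extensionality; intros j.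
apply functional_extensionality; intros r; apply functional_extensionality; intros th.
unfold sphere_metric; rewrite !chart_frameE by auto.
destruct he as (t1 & t2 & n1 & n2 & n12).
apply tangent_north_x3 in t1; auto; apply tangent_north_x3 in t2; auto.
assert (h := sin_sq_cos_sq th); assert (h' := sin_sq_cos_sq (a * r)).
unfold dot in *; rewrite t1, t2 in *; unfold x1, x2, x3 in *; simpl in *.
set (b1 := fst (fst e1)) in *; set (c1 := snd (fst e1)) in *.
set (b2 := fst (fst e2)) in *; set (c2 := snd (fst e2)) in *.
set (c := cos th) in *; set (s := sin th) in *.
set (C := cos (a * r)) in *; set (S := sin (a * r)) in *.
assert (n1' : b1 * b1 + c1 * c1 = 1) by lra.
assert (n2' : b2 * b2 + c2 * c2 = 1) by lra.
assert (n12' : b1 * b2 + c1 * c2 = 0) by lra.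
destruct i, j; simpl.
- transitivity (C * C * (c * c * (b1 * b1 + c1 * c1) + s * s * (b2 * b2 + c2 * c2)
    + 2 * s * c * (b1 * b2 + c1 * c2)) + S * S); [ring|].
  rewrite n1', n2', n12'; nra.
- transitivity (C * (S / a) * (s * c * (b2 * b2 + c2 * c2) - s * c * (b1 * b1 + c1 * c1)
    + (c * c - s * s) * (b1 * b2 + c1 * c2))); [ring|].
  rewrite n1', n2', n12'; ring.
- transitivity (C * (S / a) * (s * c * (b2 * b2 + c2 * c2) - s * c * (b1 * b1 + c1 * c1)
    + (c * c - s * s) * (b1 * b2 + c1 * c2))); [ring|].
  rewrite n1', n2', n12'; ring.
- transitivity (S / a * (S / a) * (c * c * (b2 * b2 + c2 * c2) + s * s * (b1 * b1 + c1 * c1)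
    - 2 * s * c * (b1 * b2 + c1 * c2))); [ring|].
  rewrite n1', n2', n12'.
  transitivity (S / a * (S / a) * (s * s + c * c)); [ring|rewrite h; fold S; ring].
Qed.

(** * Differentiating identities that hold on an interval *)

Lemma Derive_eq_on (f g : R -> R) (l u x d : R) : l < x < u ->
  (forall y, l < y < u -> f y = g y) -> is_derive g x d -> is_derive f x d.
Proof.
intros hx hfg hg; apply (is_derive_ext_loc g); auto.
apply (locally_interval _ _ l u); simpl; try tauto.
intros y h1 h2; symmetry; apply hfg; auto.
Qed.

Lemma derive_zero_on (f : R -> R) (l u x d : R) : l < x < u ->
  (forall y, l < y < u -> f y = 0) -> is_derive f x d -> d = 0.
Proof.
intros hx hf hd.
assert (h0 : is_derive f x 0).
{ apply (Derive_eq_on _ (fun _ => 0) l u); auto.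
  apply is_derive_Reals, derivable_pt_lim_const. }
apply is_derive_unique in hd; apply is_derive_unique in h0; lra.
Qed.

(** * Connection and curvature of the round metric *)

Section Geometry.

Variable a : R.
Hypothesis ha : 0 < a.

Lemma sin_pos_radial (r : R) : 0 < r < PI / a -> 0 < sin (a * r).
Proof.
intros [h1 h2]; apply sin_gt_0; [nra|].
apply (Rmult_lt_compat_l a) in h2; auto.
replace (a * (PI / a)) with PI in h2 by (field; lra); auto.
Qed.

(** The closed forms of the tensors are established for [0 < r < PI / a], where [sin (a * r) > 0];
    they must therefore be differentiated from a local equality. *)
Lemma pd_radial (f : field) (g : R -> R) (d r th : R) (i : coord) :
  (forall s t, 0 < s < PI / a -> f s t = g s) -> 0 < r < PI / a ->
  is_derive g r d ->
  pd i f r th = match i with Rad => d | Ang => 0 end.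
Proof.
intros hf hr hg; destruct i; simpl.
- apply is_derive_unique, (Derive_eq_on _ g 0 (PI / a)); auto.
- rewrite (Derive_ext _ (fun _ => g r)) by (intros; apply hf; auto).
  apply Derive_const.
Qed.

Lemma pd_round_metric (i j k : coord) (r th : R) :
  pd k (round_metric a i j) r th =
  match k, i, j with
  | Rad, Ang, Ang => 2 * (sin (a * r) / a) * cos (a * r)
  | _, _, _ => 0
  end.
Proof.
destruct i, j, k; simpl; try apply Derive_const.
apply is_derive_unique; auto_derive; auto; field; lra.
Qed.

Lemma gdet_round (r th : R) : gdet (round_metric a) r th = (sin (a * r) / a) ^ 2.
Proof. unfold gdet, round_metric; ring. Qed.

Lemma vol_round (r th : R) : 0 < r < PI / a ->
  vol (round_metric a) r th = sin (a * r) / a.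
Proof.
intros hr; unfold vol; rewrite gdet_round; apply sqrt_pow2.
apply Rlt_le, Rdiv_lt_0_compat; auto; apply sin_pos_radial; auto.
Qed.

Lemma ginv_round (i j : coord) (r th : R) : 0 < r < PI / a ->
  ginv (round_metric a) i j r th =
  match i, j with
  | Rad, Rad => 1
  | Ang, Ang => / (sin (a * r) / a) ^ 2
  | _, _ => 0
  end.
Proof.
intros hr; unfold ginv; rewrite gdet_round.
assert (h := sin_pos_radial r hr).
destruct i, j; unfold round_metric; field; lra.
Qed.

Lemma christoffel_round (k i j : coord) (r th : R) : 0 < r < PI / a ->
  christoffel (round_metric a) k i j r th =
  match k, i, j with
  | Rad, Ang, Ang => - (sin (a * r) / a * cos (a * r))
  | Ang, Rad, Ang | Ang, Ang, Rad => a * cos (a * r) / sin (a * r)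
  | _, _, _ => 0
  end.
Proof.
intros hr; unfold christoffel, sumc; rewrite !pd_round_metric, !ginv_round by auto.
assert (h := sin_pos_radial r hr).
destruct k, i, j; field; lra.
Qed.

Lemma pd_christoffel_round (l k i j : coord) (r th : R) : 0 < r < PI / a ->
  pd l (christoffel (round_metric a) k i j) r th =
  match l, k, i, j with
  | Rad, Rad, Ang, Ang => sin (a * r) ^ 2 - cos (a * r) ^ 2
  | Rad, Ang, Rad, Ang | Rad, Ang, Ang, Rad => - (a / sin (a * r)) ^ 2
  | _, _, _, _ => 0
  end.
Proof.
intros hr; assert (h := sin_pos_radial r hr).
assert (e := sin_sq_cos_sq (a * r)).
rewrite (pd_radial _ (fun r => match k, i, j with
  | Rad, Ang, Ang => - (sin (a * r) / a * cos (a * r))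
  | Ang, Rad, Ang | Ang, Ang, Rad => a * cos (a * r) / sin (a * r)
  | _, _, _ => 0
  end) (match k, i, j with
  | Rad, Ang, Ang => sin (a * r) ^ 2 - cos (a * r) ^ 2
  | Ang, Rad, Ang | Ang, Ang, Rad => - (a / sin (a * r)) ^ 2
  | _, _, _ => 0
  end)).
- destruct l, k, i, j; reflexivity.
- intros s t hs; apply christoffel_round; auto.
- auto.
(* This is the derivative of [a] times the cotangent; its numerator collapses by Pythagoras, which
   [field] does not see. *)
- assert (H : is_derive (fun r => a * cos (a * r) / sin (a * r)) r (- (a / sin (a * r)) ^ 2)).
  { auto_derive; [lra|].
    transitivity (- a ^ 2 * (sin (a * r) * sin (a * r) + cos (a * r) * cos (a * r)) / sin (a * r) ^ 2);
      [field; lra|rewrite e; field; lra]. }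
  destruct k, i, j; auto; auto_derive; auto; field; lra.
Qed.

(** In dimension two the Ricci tensor is the Gaussian curvature, here [a ^ 2], times the metric. *)
Lemma ricci_round (j k : coord) (r th : R) : 0 < r < PI / a ->
  ricci (round_metric a) j k r th = a ^ 2 * round_metric a j k r th.
Proof.
intros hr; assert (h := sin_pos_radial r hr).
assert (e := sin_sq_cos_sq (a * r)).
unfold ricci, riemann, sumc.
rewrite !pd_christoffel_round, !christoffel_round by auto.
destruct j, k; simpl; try (field; lra).
transitivity (a ^ 2 * (sin (a * r) * sin (a * r) + cos (a * r) * cos (a * r)
  - cos (a * r) * cos (a * r)) / sin (a * r) ^ 2); [rewrite e|]; field; lra.
Qed.

Lemma ricci1_round (w : Defs.form1) (j : coord) (r th : R) : 0 < r < PI / a ->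
  ricci1 (round_metric a) w j r th = a ^ 2 * w j r th.
Proof.
intros hr; assert (h := sin_pos_radial r hr).
unfold ricci1, sharp, sumc; rewrite !ricci_round, !ginv_round by auto.
destruct j; simpl; field; lra.
Qed.

(** * The terms of the system for a laminar flow with a twice differentiable profile *)

Section Laminar.

Variables (delta : R) (h h1 h2 : R -> R).
Hypothesis dh : forall x, is_derive h x (h1 x).
Hypothesis dh1 : forall x, is_derive h1 x (h2 x).

Let G := round_metric a.
Let u := laminar_flow a delta h.
Let w := flat G u.

Lemma flat_laminar (i : coord) (r th : R) : 0 < r < PI / a ->
  w i r th = match i with Rad => 0 | Ang => - (h (r - delta) * (sin (a * r) / a)) end.
Proof.
intros hr; assert (hs := sin_pos_radial r hr).
unfold w, u, flat, sumc, G; destruct i; simpl; field; lra.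
Qed.

Lemma sharp_flat_laminar (i : coord) (r th : R) : 0 < r < PI / a ->
  sharp G w i r th = match i with Rad => 0 | Ang => - h (r - delta) * (a / sin (a * r)) end.
Proof.
intros hr; assert (hs := sin_pos_radial r hr).
unfold sharp, sumc, G; rewrite !ginv_round, !flat_laminar by auto.
destruct i; field; lra.
Qed.

Lemma star1_laminar (i : coord) (r th : R) : 0 < r < PI / a ->
  star1 G w i r th = match i with Rad => h (r - delta) | Ang => 0 end.
Proof.
intros hr; assert (hs := sin_pos_radial r hr).
unfold star1; rewrite !sharp_flat_laminar by auto; unfold G; rewrite vol_round by auto.
destruct i; field; lra.
Qed.

Lemma is_derive_shift (f f' : R -> R) (x : R) :
  (forall x, is_derive f x (f' x)) -> is_derive (fun r => f (r - delta)) x (f' (x - delta)).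
Proof.
(* [auto_derive] presents [x - delta] as [x + - delta], hence the form of the witness. *)
intros hf; auto_derive; [exists (f' (x + - delta)); apply hf|].
rewrite (is_derive_unique _ _ _ (hf _)); unfold Rminus; ring.
Qed.

(** The Hodge star of [w] is [h (r - delta) dr], a closed form, so every profile gives a
    divergence-free flow. *)
Lemma codiff1_laminar (r th : R) : 0 < r < PI / a -> codiff1 G w r th = 0.
Proof.
intros hr; unfold codiff1, star2, ext_d1.
rewrite (pd_radial _ (fun _ => 0) 0 r th Rad); auto.
- rewrite (pd_radial _ (fun r => h (r - delta)) (h1 (r - delta)) r th Ang); auto.
  + unfold Rdiv; ring.
  + intros s t hs; apply (star1_laminar Rad); auto.
  + apply is_derive_shift, dh.
- intros s t hs; apply (star1_laminar Ang); auto.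
- apply is_derive_Reals, derivable_pt_lim_const.
Qed.

Lemma ext_d1_laminar (r th : R) : 0 < r < PI / a ->
  ext_d1 w r th = - (h1 (r - delta) * (sin (a * r) / a) + h (r - delta) * cos (a * r)).
Proof.
intros hr; unfold ext_d1.
rewrite (pd_radial (w Ang) (fun r => - (h (r - delta) * (sin (a * r) / a)))
  (- (h1 (r - delta) * (sin (a * r) / a) + h (r - delta) * cos (a * r))) r th Rad); auto.
- rewrite (pd_radial (w Rad) (fun _ => 0) 0 r th Ang); auto.
  + ring.
  + intros s t hs; apply (flat_laminar Rad); auto.
  + apply is_derive_Reals, derivable_pt_lim_const.
- intros s t hs; apply (flat_laminar Ang); auto.
-  auto_derive; [exists (h1 (r + - delta)); apply dh|].
  rewrite (is_derive_unique _ _ _ (dh _)); unfold Rminus; field; lra.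
Qed.

(** The divergence vanishes on the whole chart, so only the second summand, the rotated gradient of
    the vorticity, survives. *)
Lemma hodge_laplacian_laminar (i : coord) (r th : R) : 0 < r < PI / a ->
  hodge_laplacian G w i r th =
  match i with
  | Rad => 0
  | Ang => h2 (r - delta) * (sin (a * r) / a) + h1 (r - delta) * cos (a * r)
           - h (r - delta) * a / sin (a * r)
  end.
Proof.
intros hr; assert (hs := sin_pos_radial r hr).
assert (e := sin_sq_cos_sq (a * r)).
unfold hodge_laplacian, codiff2, ext_d0.
rewrite (pd_radial (codiff1 G w) (fun _ => 0) 0 r th i); auto.
2: intros s t hst; apply codiff1_laminar; auto.
2: apply is_derive_Reals, derivable_pt_lim_const.
(* [X] is the scalar vorticity, again a function of [r] alone. *)
set (X := star2 G (ext_d1 w)).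
assert (hX : forall s t, 0 < s < PI / a -> X s t
  = - (h1 (s - delta) + h (s - delta) * (a * cos (a * s) / sin (a * s)))).
{ intros s t hst; assert (hss := sin_pos_radial s hst).
  unfold X, star2; rewrite ext_d1_laminar by auto; unfold G; rewrite vol_round by auto.
  field; lra. }
assert (dX : forall j, pd j X r th = match j with Ang => 0 | Rad =>
   - (h2 (r - delta) + h1 (r - delta) * (a * cos (a * r) / sin (a * r))
     - h (r - delta) * (a / sin (a * r)) ^ 2) end).
{ intros j; refine (pd_radial _ _ _ r th j hX _ _); auto.
  auto_derive.
  - repeat split; try lra; [exists (h2 (r + - delta)); apply dh1|exists (h1 (r + - delta)); apply dh].
  - rewrite (is_derive_unique h _ _ (dh _)), (is_derive_unique h1 _ _ (dh1 _)).
    unfold Rminus.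
    replace ((a / sin (a * r)) ^ 2) with (a ^ 2 * (sin (a * r) * sin (a * r)
      + cos (a * r) * cos (a * r)) / sin (a * r) ^ 2) by (rewrite e; field; lra).
    field; lra. }
unfold star1, sharp, sumc; rewrite !dX; unfold G.
rewrite !ginv_round, vol_round by auto.
destruct i; field; lra.
Qed.

(** This is the centripetal acceleration along the parallels; only the symbol with upper index [Rad]
    and lower indices [Ang], [Ang] contributes. *)
Lemma flat_nabla_laminar_Rad (r th : R) : 0 < r < PI / a ->
  flat G (nabla G u u) Rad r th = - h (r - delta) ^ 2 * (a * cos (a * r) / sin (a * r)).
Proof.
intros hr; assert (hs := sin_pos_radial r hr).
unfold flat, nabla, sumc, G; rewrite !christoffel_round by auto.
unfold u; simpl; rewrite !Derive_const; field; lra.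
Qed.

Lemma flat_nabla_laminar_Ang (r th : R) : 0 < r < PI / a ->
  flat G (nabla G u u) Ang r th = 0.
Proof.
intros hr; assert (hs := sin_pos_radial r hr).
unfold flat, nabla, sumc, G; rewrite !christoffel_round by auto.
unfold u; simpl; rewrite !Derive_const; field; lra.
Qed.

End Laminar.
End Geometry.

(** * Geodesic distance from the pole *)

Lemma is_derive_acos (x : R) : -1 < x < 1 -> is_derive acos x (- / sqrt (1 - x ^ 2)).
Proof.
intros hx; apply is_derive_Reals.
replace (- / sqrt (1 - x ^ 2)) with (derive_pt acos x (derivable_pt_acos x hx)).
- apply derive_pt_eq_1 with (derivable_pt_acos x hx); reflexivity.
- rewrite derive_pt_acos; unfold Rsqr; replace (1 - x ^ 2) with (1 - x * x) by ring.
  unfold Rdiv; ring.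
Qed.

(** The sign is required in the interior only, since the speed bound for curves is proved at
    interior parameters. *)
Lemma is_derive_ge0_le (f df : R -> R) (l u : R) : l <= u ->
  (forall x, l <= x <= u -> is_derive f x (df x)) ->
  (forall x, l < x < u -> 0 <= df x) -> f l <= f u.
Proof.
intros hlu hd hp; destruct (Rle_lt_or_eq_dec _ _ hlu) as [h| ->]; [|lra].
destruct (MVT_cor2 f df l u h) as (c & e & hc).
- intros c hc; apply is_derive_Reals, hd; auto.
- assert (0 <= df c) by (apply hp; auto); nra.
Qed.

Lemma C1_real_derive (f : R -> R) (t : R) : C1_real f -> is_derive f t (Derive f t).
Proof. intros h; apply Derive_correct, h. Qed.

Lemma continuous_speed (c : R -> vec3) (t : R) :
  C1_real (fun t => x1 (c t)) -> C1_real (fun t => x2 (c t)) ->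
  C1_real (fun t => x3 (c t)) -> continuous (fun t => vnorm (vderiv c t)) t.
Proof.
intros h1 h2 h3; apply continuous_sqrt_comp.
assert (sq : forall f : R -> R, C1_real f ->
  continuous (fun t => Derive f t * Derive f t) t)
  by (intros f hf; apply (continuous_mult (K := R_AbsRing) (Derive f) (Derive f)); apply hf).
exact (continuous_plus (V := R_NormedModule) _ _ t
  (continuous_plus (V := R_NormedModule) _ _ t (sq _ h1) (sq _ h2)) (sq _ h3)).
Qed.

(* Cauchy-Schwarz for the velocity [(y1,y2,y3)], tangent at [(z1,z2,z3)], against the
   tangential projection of the third basis vector. *)
Lemma tangent_x3_sq_le (a z1 z2 z3 y1 y2 y3 : R) : 0 < a ->
  z1 * z1 + z2 * z2 + z3 * z3 = 1 / a ^ 2 -> z1 * y1 + z2 * y2 + z3 * y3 = 0 ->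
  y3 ^ 2 <= (y1 * y1 + y2 * y2 + y3 * y3) * (1 - (a * z3) ^ 2).
Proof.
intros ha hz hy.
assert (hz' : a ^ 2 * (z1 * z1 + z2 * z2 + z3 * z3) = 1) by (rewrite hz; field; lra).
set (w1 := - a ^ 2 * z3 * z1); set (w2 := - a ^ 2 * z3 * z2); set (w3 := 1 - a ^ 2 * z3 * z3).
assert (e : y3 = y1 * w1 + y2 * w2 + y3 * w3).
{ transitivity (y3 - a ^ 2 * z3 * (z1 * y1 + z2 * y2 + z3 * y3)); [rewrite hy; ring|].
  unfold w1, w2, w3; ring. }
assert (n : w1 * w1 + w2 * w2 + w3 * w3 = 1 - (a * z3) ^ 2).
{ transitivity (1 - 2 * (a * z3) ^ 2 + (a * z3) ^ 2 * (a ^ 2 * (z1 * z1 + z2 * z2 + z3 * z3)));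
    [unfold w1, w2, w3|rewrite hz']; ring. }
rewrite <- n; rewrite e at 1.
assert (0 <= (y1 * w2 - y2 * w1) ^ 2) by apply pow2_ge_0.
assert (0 <= (y1 * w3 - y3 * w1) ^ 2) by apply pow2_ge_0.
assert (0 <= (y2 * w3 - y3 * w2) ^ 2) by apply pow2_ge_0.
nra.
Qed.

(** Differentiating the constraint gives twice the inner product of position and velocity. *)
Lemma sphere_velocity_orthogonal (f1 f2 f3 : R -> R) (m l u t y1 y2 y3 : R) :
  l < t < u -> (forall s, l < s < u -> f1 s ^ 2 + f2 s ^ 2 + f3 s ^ 2 = m) ->
  is_derive f1 t y1 -> is_derive f2 t y2 -> is_derive f3 t y3 ->
  f1 t * y1 + f2 t * y2 + f3 t * y3 = 0.
Proof.
intros ht hm d1 d2 d3.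
assert (D : is_derive (fun t => f1 t ^ 2 + f2 t ^ 2 + f3 t ^ 2 - m) t
  (2 * (f1 t * y1 + f2 t * y2 + f3 t * y3))).
{ auto_derive; [repeat split; eexists; eassumption|].
  apply is_derive_unique in d1; apply is_derive_unique in d2; apply is_derive_unique in d3.
  rewrite <- d1, <- d2, <- d3; unfold Derive; ring. }
apply (derive_zero_on _ l u t _ ht) in D; [lra|].
intros s hs; rewrite (hm s hs); ring.
Qed.

Section Length.

Variables (a : R) (p q : vec3) (c : R -> vec3).
Hypothesis ha : 0 < a.
Hypothesis hc : sphere_curve a p q c.

Lemma sphere_curve_x3_speed (t : R) : 0 < t < 1 ->
  Derive (fun t => x3 (c t)) t ^ 2
    <= vnorm (vderiv c t) ^ 2 * (1 - (a * x3 (c t)) ^ 2).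
Proof.
intros ht; destruct hc as (c1 & c2 & c3 & hs & _ & _).
assert (d1 := C1_real_derive _ t c1); assert (d2 := C1_real_derive _ t c2).
assert (d3 := C1_real_derive _ t c3).
set (y1 := Derive _ t) in d1; set (y2 := Derive _ t) in d2; set (y3 := Derive _ t) in d3.
assert (n : vnorm (vderiv c t) ^ 2 = y1 * y1 + y2 * y2 + y3 * y3)
  by (transitivity (vnorm (vderiv c t) * vnorm (vderiv c t)); [ring|apply vnorm_sq]).
rewrite n; fold y3.
apply (tangent_x3_sq_le a (x1 (c t)) (x2 (c t)) (x3 (c t))); auto.
- transitivity (x1 (c t) ^ 2 + x2 (c t) ^ 2 + x3 (c t) ^ 2); [ring|apply hs; lra].
- apply (sphere_velocity_orthogonal (fun t => x1 (c t)) (fun t => x2 (c t))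
    (fun t => x3 (c t)) (1 / a ^ 2) 0 1); auto.
  intros s h; apply hs; lra.
Qed.

(* The factor [k < 1] keeps [acos] away from its singularities at the poles. *)
Lemma acos_scaled_le_length (k : R) : 0 < k < 1 ->
  acos (k * (a * x3 p)) - acos (k * (a * x3 q)) <= a * curve_length c.
Proof.
intros hk.
destruct hc as (c1 & c2 & c3 & hs & h0 & h1).
set (v := fun t => vnorm (vderiv c t)).
assert (hv : forall t, continuous v t) by (intros t; apply continuous_speed; auto).
assert (hI : forall t, is_derive (fun t => RInt v 0 t) t (v t)).
{ intros t; apply (is_derive_RInt v _ 0 t); auto.
  apply filter_forall; intros s; apply (RInt_correct (V := R_CompleteNormedModule)).
  apply (ex_RInt_continuous (V := R_CompleteNormedModule)); auto. }
(* [F] is nondecreasing on [[0,1]], and [F 0 <= F 1] is the claim rearranged. *)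
set (F := fun t => a * RInt v 0 t + acos (k * (a * x3 (c t)))).
set (z := fun t => a * x3 (c t)).
assert (hz : forall t, 0 <= t <= 1 -> z t ^ 2 <= 1).
{ intros t ht; assert (e := hs t ht); unfold sphere in e.
  replace 1 with (a ^ 2 * (1 / a ^ 2)) by (field; lra).
  rewrite <- e; unfold z; assert (0 < a ^ 2) by (apply pow_lt; auto).
  assert (0 <= x1 (c t) ^ 2) by apply pow2_ge_0.
  assert (0 <= x2 (c t) ^ 2) by apply pow2_ge_0. nra. }
assert (hkz : forall t, 0 <= t <= 1 -> -1 < k * z t < 1).
{ intros t ht; assert (e := hz t ht); assert (-1 <= z t <= 1) by nra; nra. }
assert (hF : F 0 <= F 1).
{ apply (is_derive_ge0_le F (fun t => a * v t + k * (a * Derive (fun t => x3 (c t)) t)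
    * (- / sqrt (1 - (k * z t) ^ 2)))); [lra| |].
  - intros t ht; apply (is_derive_plus (V := R_NormedModule)).
    + apply is_derive_scal, hI.
    + apply (is_derive_comp acos (fun t => k * (a * x3 (c t)))).
      * apply is_derive_acos, hkz; auto.
      * do 2 apply is_derive_scal; apply C1_real_derive; auto.
  - intros t ht.
    assert (hk1 := hkz t ltac:(lra)); assert (hz1 := hz t ltac:(lra)).
    assert (sp : 0 < 1 - (k * z t) ^ 2) by nra.
    assert (sq := sqrt_lt_R0 _ sp); set (s := sqrt _) in *.
    assert (ss : s ^ 2 = 1 - (k * z t) ^ 2) by (apply pow2_sqrt; lra).
    set (d := Derive (fun t => x3 (c t)) t).
    assert (hd : d ^ 2 <= v t ^ 2 * (1 - z t ^ 2)) by exact (sphere_curve_x3_speed t ht).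
    assert (v0 : 0 <= v t) by apply sqrt_pos.
    (* By squaring: [k^2 d^2 <= d^2 <= v^2 (1 - z^2) <= v^2 (1 - k^2 z^2) = v^2 s^2]. *)
    assert (H : k * d <= v t * s).
    { apply Rsqr_incr_0_var; [|nra].
      unfold Rsqr; apply Rle_trans with (1 * d ^ 2).
      { replace (k * d * (k * d)) with (k ^ 2 * d ^ 2) by ring.
        apply Rmult_le_compat_r; [apply pow2_ge_0|nra]. }
      apply Rle_trans with (v t ^ 2 * (1 - z t ^ 2)); [lra|].
      replace (v t * s * (v t * s)) with (v t ^ 2 * s ^ 2) by ring; rewrite ss.
      apply Rmult_le_compat_l; [apply pow2_ge_0|].
      assert (k ^ 2 <= 1) by nra; assert (hz0 := pow2_ge_0 (z t)).
      replace ((k * z t) ^ 2) with (k ^ 2 * z t ^ 2) by ring; nra. }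
    replace (a * v t + k * (a * d) * - / s) with (a * (v t * s - k * d) / s) by (field; lra).
    apply Rdiv_le_0_compat; auto; apply Rmult_le_pos; lra. }
assert (i0 : RInt v 0 0 = 0) by exact (RInt_point 0 v).
unfold F in hF; rewrite i0, h0, h1 in hF.
change (RInt v 0 1) with (curve_length c) in hF; lra.
Qed.

(** Taking [k = cos eta] turns the term at the pole into [eta], so
    [acos (cos eta * cos rho) <= L + eta]. If [L < rho], then [f] is positive at [0] by strict
    monotonicity of the cosine, hence near [0] by continuity, against this bound for small
    [eta > 0]. *)
Lemma length_to_north_ge (rho : R) : 0 < rho < PI -> a * x3 p = cos rho ->
  a * x3 q = 1 -> rho <= a * curve_length c.
Proof.
intros hr hp hq; apply Rnot_lt_le; intros hlt.
set (L := a * curve_length c) in *.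
assert (hL : 0 <= L).
{ apply Rmult_le_pos; [lra|].
  destruct hc as (c1 & c2 & c3 & _); apply RInt_ge_0; [lra| |intros; apply sqrt_pos].
  apply (ex_RInt_continuous (V := R_CompleteNormedModule)); intros; apply continuous_speed; auto. }
set (f := fun eta => cos (L + eta) - cos eta * cos rho).
assert (hf : forall eta, 0 < eta < PI / 2 -> L + eta <= PI -> f eta <= 0).
{ intros eta h1 h2.
  assert (hk : 0 < cos eta < 1).
  { split; [apply cos_gt_0; lra|rewrite <- cos_0; apply cos_decreasing_1; lra]. }
  assert (H := acos_scaled_le_length (cos eta) hk); fold L in H.
  rewrite hp, hq, Rmult_1_r, acos_cos in H by lra.
  assert (hb : -1 <= cos eta * cos rho <= 1).
  { assert (h := COS_bound rho); nra. }
  unfold f; rewrite <- (cos_acos _ hb).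
  destruct (Rle_lt_or_eq_dec (acos (cos eta * cos rho)) (L + eta)) as [h|h]; [lra| |rewrite h; lra].
  assert (hb' := acos_bound (cos eta * cos rho)).
  apply Rlt_le, Rlt_minus, cos_decreasing_1; lra. }
assert (f0 : 0 < f 0).
{ unfold f; rewrite Rplus_0_r, cos_0, Rmult_1_l; apply Rlt_0_minus, cos_decreasing_1; lra. }
assert (cf : continuous f 0).
{ apply (ex_derive_continuous (V := R_NormedModule)); unfold f; auto_derive; auto. }
destruct (cf (fun y => 0 < y)) as [[d hd] H].
{ exists (mkposreal _ f0); intros y hy.
  unfold ball in hy; simpl in hy; unfold AbsRing_ball, abs, minus, plus, opp in hy; simpl in hy.
  apply Rabs_def2 in hy; lra. }
(* [m] lies in the continuity neighbourhood and satisfies [m < PI / 2] and [L + m <= PI], as [hf]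
   demands. *)
set (m := Rmin d (Rmin (PI / 2) (PI - L)) / 2).
assert (0 < Rmin d (Rmin (PI / 2) (PI - L))).
{ repeat apply Rmin_pos; lra. }
assert (m1 := Rmin_l d (Rmin (PI / 2) (PI - L))).
assert (m2 := Rmin_r d (Rmin (PI / 2) (PI - L))).
assert (m3 := Rmin_l (PI / 2) (PI - L)); assert (m4 := Rmin_r (PI / 2) (PI - L)).
assert (f m <= 0) by (apply hf; unfold m; lra).
assert (0 < f m); [|lra].
apply H; unfold ball; simpl; unfold AbsRing_ball, abs, minus, plus, opp; simpl.
rewrite Ropp_0, Rplus_0_r, Rabs_pos_eq; unfold m; lra.
Qed.

End Length.

(** The infimum is attained: [length_to_north_ge] bounds every length below by [r], and the meridian
    has length [r]. *)
Lemma geodesic_dist_polar_chart (a : R) (e1 e2 : vec3) (r th : R) :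
  0 < a -> orthonormal_at_north a e1 e2 -> 0 < r < PI / a ->
  geodesic_dist a (polar_chart a e1 e2 r th) (north a) = r.
Proof.
intros ha he hr; unfold geodesic_dist.
assert (hp : 0 < a * r < PI).
{ split; [nra|]; destruct hr as [_ h]; apply (Rmult_lt_compat_l a) in h; auto.
  replace (a * (PI / a)) with PI in h by (field; lra); auto. }
rewrite (is_glb_Rbar_unique _ (Finite r)); [reflexivity|split].
- intros L (c & hc & ->); simpl.
  assert (h := length_to_north_ge a _ _ c ha hc (a * r) hp).
  apply (Rmult_le_reg_l a); auto; apply h.
  + rewrite polar_chartE by auto; unfold x3; simpl; field; lra.
  + unfold x3; simpl; field; lra.
- intros b hb; apply hb.
  set (b1 := cos th * x1 e1 + sin th * x1 e2); set (b2 := cos th * x2 e1 + sin th * x2 e2).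
  (* The meridian run from the point down to [r = 0], the pole; its velocity is [- r] times the
     radial frame vector. *)
  set (c := fun t => polar_chart a e1 e2 (r * (1 - t)) th).
  assert (ec : c = fun t => (sin (a * (r * (1 - t))) / a * b1,
     sin (a * (r * (1 - t))) / a * b2, cos (a * (r * (1 - t))) / a)).
  { unfold c; rewrite polar_chartE by auto; reflexivity. }
  assert (dc : forall t, vderiv c t = vscal (- r) (chart_frame a e1 e2 Rad (r * (1 - t)) th)).
  { intros t; rewrite ec, chart_frameE by auto; fold b1 b2; unfold vderiv, vscal.
    apply f_equal2; [apply f_equal2|]; apply is_derive_unique; unfold x1, x2, x3; simpl;
      auto_derive; auto; unfold Rminus; field; lra. }
  assert (C1 : forall f df : R -> R, (forall t, is_derive f t (df t)) ->
    (forall t, ex_derive df t) -> C1_real f).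
  { intros f df h h' t; split; [eexists; apply h|].
    apply (continuous_ext df); [intros s; symmetry; apply is_derive_unique, h|].
    apply (ex_derive_continuous (V := R_NormedModule)); auto. }
  exists c; split; [split; [|split; [|split; [|split; [|split]]]]|].
  + apply (C1 _ (fun t => - r * cos (a * (r * (1 - t))) * b1)); intros t; rewrite ?ec;
      unfold x1; simpl; auto_derive; auto; unfold Rminus; field; lra.
  + apply (C1 _ (fun t => - r * cos (a * (r * (1 - t))) * b2)); intros t; rewrite ?ec;
      unfold x2; simpl; auto_derive; auto; unfold Rminus; field; lra.
  + apply (C1 _ (fun t => r * sin (a * (r * (1 - t))))); intros t; rewrite ?ec;
      unfold x3; simpl; auto_derive; auto; unfold Rminus; field; lra.
  + intros t _; apply polar_chart_sphere; auto.
  + unfold c; f_equal; ring.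
  + rewrite ec; unfold north; replace (a * (r * (1 - 1))) with 0 by ring.
    rewrite sin_0, cos_0; apply f_equal2; [apply f_equal2|]; field; lra.
  + unfold curve_length.
    rewrite (RInt_ext _ (fun _ => r)).
    * rewrite RInt_const; unfold scal; simpl; unfold mult; simpl; ring.
    (* The speed is constant because the radial frame vector has unit length. *)
    * intros t _; rewrite dc; unfold vnorm.
      transitivity (sqrt (r ^ 2)); [|apply sqrt_pow2; lra]; f_equal.
      assert (hm : sphere_metric a e1 e2 Rad Rad (r * (1 - t)) th = 1)
        by (rewrite sphere_metricE; auto).
      unfold sphere_metric in hm; set (y := chart_frame _ _ _ _ _ _) in *.
      transitivity (r ^ 2 * dot y y); [unfold dot, vscal, x1, x2, x3; simpl|rewrite hm]; ring.
Qed.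

(** * Separation of the pressure and incompatibility of the quadratic profile *)

Lemma cos_neq0_subinterval (a l u : R) : 0 < a -> 0 < l < u -> u < PI / a ->
  exists u', l < u' <= u /\
  exists l', l <= l' < u' /\ forall r, l' < r < u' -> cos (a * r) <> 0.
Proof.
intros ha hl hu.
assert (hp : forall r, a * r < PI <-> r < PI / a).
{ intros r; split; intros h.
  - apply (Rmult_lt_reg_l a); auto; replace (a * (PI / a)) with PI by (field; lra); auto.
  - apply (Rmult_lt_compat_l a) in h; auto; replace (a * (PI / a)) with PI in h by (field; lra); auto. }
(* The cosine vanishes only at [r = PI / (2 a)] in this range; the part of the interval next to [l]
   on one side of that point is kept. *)
destruct (Rlt_le_dec (a * l) (PI / 2)) as [h|h].
- set (m := PI / (2 * a)).
  assert (hm : a * m = PI / 2) by (unfold m; field; lra).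
  assert (l < m) by nra.
  exists (Rmin u m); assert (h1 := Rmin_l u m); assert (h2 := Rmin_r u m).
  assert (l < Rmin u m) by (apply Rmin_glb_lt; lra).
  split; [lra|]; exists l; split; [lra|].
  intros r hr; apply Rgt_not_eq, cos_gt_0; [|nra].
  assert (0 < a * r) by nra; assert (0 < PI) by apply PI_RGT_0; lra.
- exists u; split; [lra|]; exists l; split; [lra|].
  intros r hr; apply Rlt_not_eq, cos_lt_0; [nra|].
  assert (a * r < PI) by (apply hp; lra); assert (0 < PI) by apply PI_RGT_0; lra.
Qed.

(** An integrated form of the equality of mixed partial derivatives, which uses first derivatives
    only: the increment of [p] between two angles is a constant times [B], and its [r]-derivative is
    [A r - A r]. *)
Lemma pressure_separation (p : field) (A B : R -> R) (l u tau : R) : 0 < tau ->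
  (forall r th, l < r < u -> 0 < th < tau ->
     ex_pd Rad p r th /\ ex_pd Ang p r th /\ pd Rad p r th = A r /\ pd Ang p r th = B r) ->
  forall r d, l < r < u -> is_derive B r d -> d = 0.
Proof.
intros ht hp r d hr hB.
set (t1 := tau / 4); set (t2 := tau / 2).
assert (hd : forall s, l < s < u -> tau / 4 * B s = p s t2 - p s t1).
{ intros s hs.
  (* The mean value theorem gives the exact increment, as the angular derivative does not depend on
     the angle. *)
  destruct (MVT_cor2 (p s) (fun _ => B s) t1 t2) as (c & e & _); [unfold t1, t2; lra| |].
  - intros t htt; apply is_derive_Reals.
    destruct (hp s t) as (_ & h & _ & e); auto; [unfold t1, t2 in htt; lra|].
    rewrite <- e; apply (Derive_correct (p s)), h.
  - rewrite e; unfold t1, t2; field. }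
assert (h : tau / 4 * d = 0); [|nra].
assert (dp : forall t, 0 < t < tau -> is_derive (fun s => p s t) r (A r)).
{ intros t htt; destruct (hp r t) as (h & _ & e & _); auto.
  rewrite <- e; apply (Derive_correct (fun s => p s t)), h. }
assert (D : is_derive (fun s => tau / 4 * B s - (p s t2 - p s t1)) r
  (tau / 4 * d - (A r - A r))).
{ apply (is_derive_minus (V := R_NormedModule)); [apply is_derive_scal; auto|].
  apply (is_derive_minus (V := R_NormedModule)); apply dp; unfold t1, t2; lra. }
assert (tau / 4 * d - (A r - A r) = 0); [|lra].
apply (derive_zero_on _ l u r _ hr) in D; auto.
intros y hy; rewrite hd by auto; ring.
Qed.

Section Contradiction.

Variables (a delta alpha1 alpha2 : R).
Hypotheses (ha : 0 < a) (halpha2 : 0 < alpha2).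

Let h (r : R) : R := poiseuille alpha1 alpha2 (r - delta).
Let h' (r : R) : R := alpha1 - alpha2 * (r - delta).
(** The coefficient of [cos (a * r)] left when [2 * a * sin (a * r)] is divided out of the
    derivative of the bracket in [poiseuille_balance_absurd]. *)
Let k (r : R) : R := 2 * a * h r - 3 * alpha2 / (2 * a).

(* Eliminating [sin] and [cos] between this relation and its derivative leaves a
   polynomial of degree four in [r], which is differentiated until it breaks. *)
Lemma poiseuille_first_order_absurd (l u : R) : l < u ->
  ~ (forall r, l < r < u -> 2 * h' r * sin (a * r) + k r * cos (a * r) = 0).
Proof.
intros hlu Q.
assert (Q' : forall r, l < r < u ->
  4 * a * h' r * cos (a * r) - (2 * alpha2 + a * k r) * sin (a * r) = 0).
{ intros r hr; apply (derive_zero_on _ l u r _ hr Q).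
  unfold k, h, h', poiseuille; auto_derive; auto; field; lra. }
(* [Q] and [Q'] form a homogeneous linear system for the nonzero vector of sine and cosine, so its
   determinant vanishes; the determinant is shown to annihilate both entries. *)
assert (E : forall r, l < r < u -> 8 * a * h' r ^ 2 + 2 * alpha2 * k r + a * k r ^ 2 = 0).
{ intros r hr; assert (q := Q r hr); assert (q' := Q' r hr).
  assert (e := sin_sq_cos_sq (a * r)).
  set (X := 8 * a * h' r ^ 2 + _ + _).
  assert (X * sin (a * r) = 0).
  { transitivity (4 * a * h' r * (2 * h' r * sin (a * r) + k r * cos (a * r))
      - k r * (4 * a * h' r * cos (a * r) - (2 * alpha2 + a * k r) * sin (a * r)));
      [unfold X; ring|rewrite q, q'; ring]. }
  assert (X * cos (a * r) = 0).
  { transitivity ((2 * alpha2 + a * k r) * (2 * h' r * sin (a * r) + k r * cos (a * r))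
      + 2 * h' r * (4 * a * h' r * cos (a * r) - (2 * alpha2 + a * k r) * sin (a * r)));
      [unfold X; ring|rewrite q, q'; ring]. }
  transitivity (X * (sin (a * r) * sin (a * r) + cos (a * r) * cos (a * r)));
    [rewrite e; ring|].
  rewrite Rmult_plus_distr_l, <- !Rmult_assoc, H, H0; ring. }
(* Each differentiation uses that [h'] has derivative [- alpha2] and [k] has derivative
   [2 * a * h']; the third yields [h' = 0] and the fourth [alpha2 = 0]. *)
assert (E1 : forall r, l < r < u -> h' r * (a * k r - 3 * alpha2) = 0).
{ intros r hr.
  assert (H : 4 * a * (h' r * (a * k r - 3 * alpha2)) = 0);
    [|apply Rmult_integral in H; destruct H; lra].
  apply (derive_zero_on _ l u r _ hr E).
  unfold k, h, h', poiseuille; auto_derive; auto; field; lra. }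
assert (E2 : forall r, l < r < u -> 2 * a ^ 2 * h' r ^ 2 - alpha2 * (a * k r - 3 * alpha2) = 0).
{ intros r hr; apply (derive_zero_on _ l u r _ hr E1).
  unfold k, h, h', poiseuille; auto_derive; auto; field; lra. }
assert (E3 : forall r, l < r < u -> h' r = 0).
{ intros r hr.
  assert (H : - 6 * a ^ 2 * alpha2 * h' r = 0).
  { apply (derive_zero_on _ l u r _ hr E2).
    unfold k, h, h', poiseuille; auto_derive; auto; field; lra. }
  assert (0 < a ^ 2 * alpha2) by (apply Rmult_lt_0_compat; [apply pow_lt|]; auto); nra. }
assert (- alpha2 = 0); [|lra].
apply (derive_zero_on h' l u ((l + u) / 2)); auto; [lra|].
unfold h'; auto_derive; auto; ring.
Qed.

(* The function is [-1/nu] times the [theta]-derivative of the pressure.  Its derivative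
   is [a cos (a r) / sin^2 (a r)] times a bracket, which vanishes where [cos (a r)] does
   not; the derivative of the bracket is [2 a sin (a r)] times the expression of
   [poiseuille_first_order_absurd]. *)
Lemma poiseuille_balance_absurd (l u : R) : l < u -> 0 < l -> u < PI / a ->
  (forall r, l < r < u -> forall d,
   is_derive (fun r => - alpha2 * (sin (a * r) / a) + h' r * cos (a * r)
     + h r * (2 * a * sin (a * r) - a / sin (a * r))) r d -> d = 0) -> False.
Proof.
intros hlu hl hu H.
assert (hs : forall r, l < r < u -> 0 < sin (a * r)) by (intros; apply sin_pos_radial; lra).
destruct (cos_neq0_subinterval a l u) as (u' & hu' & l' & hl' & hc); auto.
assert (F : forall r, l' < r < u' ->
   - 2 * alpha2 / a * sin (a * r) ^ 2 - h' r * cos (a * r) * sin (a * r)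
    + a * h r * (2 * sin (a * r) ^ 2 + 1) = 0).
{ intros r hr; assert (s0 := hs r ltac:(lra)); assert (c0 := hc r hr).
  assert (e := sin_sq_cos_sq (a * r)).
  assert (D : cos (a * r) * (- 2 * alpha2 / a * sin (a * r) ^ 2 - h' r * cos (a * r) * sin (a * r)
    + a * h r * (2 * sin (a * r) ^ 2 + 1)) * (a / sin (a * r) ^ 2) = 0).
  { apply (H r); [lra|].
    unfold h, h', poiseuille; auto_derive; [lra|].
    (* The added term is zero by Pythagoras and turns the goal into a rational identity in the sine
       and cosine. *)
    match goal with |- _ = ?R => transitivity (R + a * (alpha1 - alpha2 * (r - delta))
      * (sin (a * r) * sin (a * r) + cos (a * r) * cos (a * r) - 1) / sin (a * r)) end;
      [field; lra|rewrite e; unfold Rdiv; ring]. }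
  apply Rmult_integral in D; destruct D as [D|D].
  - apply Rmult_integral in D; destruct D as [D|D]; [contradiction|auto].
  - assert (0 < a / sin (a * r) ^ 2) by (apply Rdiv_lt_0_compat; auto; apply pow_lt; auto); lra. }
apply (poiseuille_first_order_absurd l' u'); [lra|].
intros r hr; assert (s0 := hs r ltac:(lra)).
assert (e := sin_sq_cos_sq (a * r)).
assert (D : 2 * a * sin (a * r) * (2 * h' r * sin (a * r) + k r * cos (a * r)) = 0).
{ apply (derive_zero_on _ l' u' r _ hr F).
  unfold k, h, h', poiseuille; auto_derive; auto.
  match goal with |- _ = ?R => transitivity (R + a * (alpha1 - alpha2 * (r - delta))
    * (1 - (sin (a * r) * sin (a * r) + cos (a * r) * cos (a * r)))) end;
    [field; lra|rewrite e; ring]. }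
apply Rmult_integral in D; destruct D as [D|D]; auto.
assert (0 < 2 * a * sin (a * r)) by (apply Rmult_lt_0_compat; lra); lra.
Qed.
End Contradiction.

(** * The coordinate rectangle and the conclusion *)

Lemma exterior_region_chart (a : R) (e1 e2 : vec3) (delta tau eps0 r th : R) :
  0 < a -> orthonormal_at_north a e1 e2 -> 0 < delta -> tau < 2 * PI ->
  delta + eps0 < PI / a -> delta < r < delta + eps0 -> 0 < th < tau ->
  chart_domain a e1 e2 (exterior_region a e1 e2 delta tau eps0) r th.
Proof.
intros ha he hd ht hde hr hth.
assert (0 < r < PI / a) by lra; assert (0 < th < 2 * PI) by lra.
split; [|split; [|split; [|split]]]; auto.
- apply polar_chart_sphere; auto.
(* Here the distance in the definition of the region becomes the coordinate [r]. *)
- rewrite geodesic_dist_polar_chart; auto.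
- exists r, th; repeat split; tauto.
Qed.

Theorem theorem1p4
  (a nu beta : R) (e1 e2 : vec3)
  (delta tau eps0 : R) (K : vec3 -> Prop) (alpha1 alpha2 : R)
  (ha : 0 < a) (hnu : 0 < nu) (hbeta : 0 <= beta)
  (he : orthonormal_at_north a e1 e2)
  (hdelta : 0 < delta < PI / a)
  (htau : 0 < tau < 2 * PI)
  (hKcompact : compact_set K)
  (hKball : forall p, K p -> sphere a p /\ geodesic_dist a p (north a) <= delta)
  (hKarc : forall p, arc a e1 e2 delta tau p -> boundary_in (sphere a) K p)
  (heps0 : 0 < eps0) (hdeltaeps0 : delta + eps0 < PI / a)
  (halpha1 : 0 < alpha1) (halpha2 : 0 < alpha2) :
  ~ solves_navier_stokes a nu beta e1 e2
      (exterior_region a e1 e2 delta tau eps0)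
      (laminar_flow a delta (poiseuille alpha1 alpha2)).
Proof.
intros (P & hP & hNS).
rewrite sphere_metricE in hNS by auto.
set (D := chart_domain a e1 e2 (exterior_region a e1 e2 delta tau eps0)) in *.
set (p := fun r th => P (polar_chart a e1 e2 r th)) in *.
set (h := poiseuille alpha1 alpha2) in *.
set (h1 := fun x => alpha1 - alpha2 * x); set (h2 := fun _ : R => - alpha2).
assert (dh : forall x, is_derive h x (h1 x)).
{ intros x; unfold h, h1, poiseuille; auto_derive; auto; field. }
assert (dh1 : forall x, is_derive h1 x (h2 x)).
{ intros x; unfold h1, h2; auto_derive; auto; ring. }
(* Viscosity and curvature enter only the angular equation, giving [- nu * Phi]; the Coriolis and
   centripetal terms enter only the radial one, giving [A]. *)
set (Phi := fun r => - alpha2 * (sin (a * r) / a) + h1 (r - delta) * cos (a * r)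
  + h (r - delta) * (2 * a * sin (a * r) - a / sin (a * r))).
set (A := fun r => - beta * cos (a * r) * h (r - delta)
  + h (r - delta) ^ 2 * (a * cos (a * r) / sin (a * r))).
assert (hp : forall r th, delta < r < delta + eps0 -> 0 < th < tau ->
  ex_pd Rad p r th /\ ex_pd Ang p r th /\ pd Rad p r th = A r
  /\ pd Ang p r th = - nu * Phi r).
{ intros r th hr hth.
  assert (hD : D r th) by (apply exterior_region_chart; tauto).
  assert (hr' : 0 < r < PI / a) by lra.
  assert (hs := sin_pos_radial a ha r hr').
  destruct (hP 1%nat) as [_ hd].
  destruct (hNS r th hD) as [E _].
  split; [apply (hd Rad); auto|split; [apply (hd Ang); auto|split]].
  - assert (E' := E Rad); unfold ext_d0 in E'.
    rewrite (hodge_laplacian_laminar a ha delta h h1 h2) in E' by auto.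
    rewrite ricci1_round, flat_laminar, star1_laminar, flat_nabla_laminar_Rad in E' by auto.
    unfold A; lra.
  - assert (E' := E Ang); unfold ext_d0 in E'.
    rewrite (hodge_laplacian_laminar a ha delta h h1 h2) in E' by auto.
    rewrite ricci1_round, flat_laminar, star1_laminar, flat_nabla_laminar_Ang in E' by auto.
    apply Rminus_diag_uniq; rewrite <- E'; unfold Phi, h2; field; lra. }
apply (poiseuille_balance_absurd a delta alpha1 alpha2 ha halpha2 delta (delta + eps0));
  try lra.
intros r hr d hd.
assert (H : - nu * d = 0); [|apply Rmult_integral in H; destruct H; lra].
apply (pressure_separation p A (fun r => - nu * Phi r) delta (delta + eps0) tau ltac:(lra) hp r);
  auto.
apply is_derive_scal, hd.
Qed.
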